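(* Let $(a_1,\dots,a_n)\in\Sigma$ and $S=\{\pm a_1,\dots,\pm a_n\}$. Then $\chi(a_1,\dots,a_n)\ge \kappa_S+1\ge\lambda_S+1\ge 3$.
   Context: $\Sigma$ is the set of strictly increasing sequences $a_1<\dots<a_n$ of positive integers with $\gcd(a_1,\dots,a_n)=1$. The shift action is $(s\cdot x)(m)=x(m+s)$ on $2^\mathbb{Z}$; $F(2^\mathbb{Z})$ is the set of $x$ with $s\cdot x\ne x$ for all $s\ne0$. The Schreier graph $G_S$ on $F(2^\mathbb{Z})$ joins $x,y$ iff $s\cdot x=y$ for some $s\in S$. $\chi(a_1,\dots,a_n)$ is the Borel chromatic number of $G_S$ (least size of a finite discrete set $K$ admitting a Borel proper coloring $F(2^\mathbb{Z})\to K$). The Cayley graph $C_S$ has vertex set $\mathbb{Z}$ with $u,v$ adjacent iff $u-v\in S$. $K_S$ is the subgraph of $C_S$ induced by $\{0,a_1,\dots,a_n\}$; $\lambda_S$ is the size of the largest clique in $K_S$ and $\kappa_S$ is the chromatic number of $K_S$. *)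

(* Defs.v *)
From HB Require Import structures.
From mathcomp Require Import all_boot all_order all_algebra.
From mathcomp Require Import all_classical all_reals all_analysis.

Set Implicit Arguments.
Unset Strict Implicit.
Unset Printing Implicit Defensive.

Import Order.TTheory GRing.Theory Num.Theory.

Local Open Scope classical_set_scope.
Local Open Scope ring_scope.

(* The value is the junk 0 when P is empty.  No lower bound by a positive
   number can hold in that case, so a statement [0 < m <= least P] also
   asserts that P is nonempty. *)
Definition least (P : set nat) : nat :=
  xget 0%N [set k | P k /\ forall j, P j -> (k <= j)%N].

Definition proper_coloring (V K : Type) (E : V -> V -> Prop) (c : V -> K) :=
  forall x y, E x y -> c x <> c y.

Definition chromatic_number (V : finType) (E : rel V) : nat :=
  least [set k | exists (K : finType) (c : V -> K),
    #|K| = k /\ proper_coloring E c].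

Definition clique (V : finType) (E : rel V) (A : {set V}) : bool :=
  [forall x in A, forall y in A, (x != y) ==> E x y].

Definition clique_number (V : finType) (E : rel V) : nat :=
  (\max_(A : {set V} | clique E A) #|A|)%N.

(* [<<s open >>] is the Borel sigma-algebra of X. *)
Definition borel_map (X : topologicalType) (K : Type) (c : X -> K) :=
  forall A : set K, <<s (@open X) >> (c @^-1` A).

Definition borel_chromatic_number (X : topologicalType) (E : X -> X -> Prop) :
    nat :=
  least [set k | exists (K : finType) (c : X -> K),
    [/\ #|K| = k, borel_map c & proper_coloring E c]].

Definition twoZ : topologicalType := prod_topology (fun _ : int => bool).

Definition zshift (s : int) (x : twoZ) : twoZ := fun m => x (m + s).

Definition free_part : set twoZ :=
  [set x | forall s : int, s != 0 -> zshift s x <> x].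

(* As a type, [free_part] carries the subspace topology induced by [twoZ]. *)
Definition schreier (S : seq int) (x y : free_part) : Prop :=
  exists2 s, s \in S & zshift s (set_val x) = set_val y.

Definition Sigma (a : seq nat) : bool :=
  [&& sorted ltn a, all (leq 1) a & \big[gcdn/0%N]_(m <- a) m == 1%N].

Definition pm (a : seq nat) : seq int :=
  [seq m%:Z | m <- a] ++ [seq - m%:Z | m <- a].

Definition chi (a : seq nat) : nat :=
  borel_chromatic_number (@schreier (pm a)).

Definition cayley (S : seq int) : rel int := fun u v => u - v \in S.

Definition K_vertex (a : seq nat) : finType :=
  seq_sub (0 :: [seq m%:Z | m <- a]).

Definition K_graph (a : seq nat) : rel (K_vertex a) :=
  fun u v => cayley (pm a) (val u) (val v).

Definition lambda (a : seq nat) : nat := clique_number (@K_graph a).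

Definition kappa (a : seq nat) : nat := chromatic_number (@K_graph a).

(* Main.v *)
(** In K_S the vertex 0 is adjacent to all others.  Hence, if c is a proper
    coloring of G_S with at most kappa_S colors, then along every orbit the color
    of x is the only color missing from c (a_1 x), ..., c (a_n x).  The colors on
    a window of length a_n thus determine everything to their left, so c is
    invariant under the shift by some N > 0 that does not depend on the orbit.
    If c is Borel, some color class is comeager in a cylinder; for large k that
    cylinder meets its translate by b + k N in a cylinder, where b = a_i.  A
    generic point x there has c x = c ((b + k N) x) = c (b x), a contradiction.

    The Borel chromatic number is finite because the shift by each a_i generates
    a graph of degree 2 with a Borel 3-coloring. *)

Require Import Defs.
From mathcomp Require Import all_boot.
From mathcomp Require Import all_order all_algebra all_classical all_reals all_analysis.
From mathcomp Require Import zify.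

Set Implicit Arguments.
Unset Strict Implicit.
Unset Printing Implicit Defensive.

Import Order.TTheory GRing.Theory Num.Theory.

Section LowerBound.
Local Open Scope classical_set_scope.
Local Open Scope ring_scope.

(** * Minima, and colorings and cliques of finite graphs *)

Lemma leastP (P : set nat) k : P k -> P (least P) /\ (least P <= k)%N.
Proof.
move=> Pk; rewrite /least; case: xgetP => [m _ [Pm minm]|none].
  by split=> //; exact: minm.
have ex : exists n, `[< P n >] by exists k; apply/asboolP.
case: (none (ex_minn ex)); case: ex_minnP => m /asboolP Pm minm.
by split=> // j Pj; apply: minm; apply/asboolP.
Qed.

Lemma chromatic_number_le (V : finType) (E : rel V) (K : finType) (c : V -> K) :
  proper_coloring E c -> (chromatic_number E <= #|K|)%N.
Proof. by move=> pc; apply: (leastP _).2; exists K, c. Qed.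

Lemma clique_number_le_chromatic (V : finType) (E : rel V) :
  irreflexive E -> (clique_number E <= chromatic_number E)%N.
Proof.
move=> irrE.
have [K [c [<- pc]]] : [set k | exists (K : finType) (c : V -> K),
    #|K| = k /\ proper_coloring E c] (chromatic_number E).
  (* The identity coloring makes the set of color counts nonempty, so [least] is attained. *)
  apply: (@leastP _ #|V| _).1; exists V, id; split=> // x y + xy.
  by rewrite xy irrE.
apply/bigmax_leqP => A /forall_inP clA.
rewrite -(@card_in_imset _ _ c) ?max_card // => x y xA yA cxy.
apply: contraTeq isT => /(implyP (forall_inP (clA x xA) y yA)) /pc.
by rewrite cxy.
Qed.

Lemma mem_pm (a : seq nat) (s : int) :
  (s \in pm a) = has (fun m => (s == m%:Z) || (s == - m%:Z)) a.
Proof.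
rewrite /pm mem_cat; apply/orP/hasP.
  by case=> /mapP[m ma ->]; exists m => //; rewrite eqxx ?orbT.
by case=> m ma /orP[]/eqP->; [left|right]; apply: map_f.
Qed.

Lemma pmN (a : seq nat) (s : int) : (- s \in pm a) = (s \in pm a).
Proof.
by rewrite !mem_pm; apply: eq_has => m; rewrite eqr_oppLR eqr_opp orbC.
Qed.

Lemma mem_pm_nat (a : seq nat) m : m \in a -> m%:Z \in pm a.
Proof. by move=> ma; rewrite mem_pm; apply/hasP; exists m; rewrite ?eqxx. Qed.

Lemma Sigma_gt0 (a : seq nat) m : Sigma a -> m \in a -> (0 < m)%N.
Proof. by case/and3P=> _ /allP h _ /h. Qed.

Lemma Sigma_nonempty (a : seq nat) : Sigma a -> exists m, m \in a.
Proof.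
case: a => [/and3P[_ _]|m a _]; first by rewrite big_nil.
by exists m; exact: mem_head.
Qed.

Lemma pm_neq0 (a : seq nat) (s : int) : Sigma a -> s \in pm a -> s != 0.
Proof.
move=> Sa; rewrite mem_pm => /hasP[m ma].
by have := Sigma_gt0 Sa ma; lia.
Qed.

Lemma K_graph_irr (a : seq nat) : Sigma a -> irreflexive (@K_graph a).
Proof.
move=> Sa x; rewrite /K_graph /cayley subrr; apply/negP => /(pm_neq0 Sa).
by rewrite eqxx.
Qed.

Lemma lambda_ge2 (a : seq nat) : Sigma a -> (2 <= lambda a)%N.
Proof.
move=> Sa; have [m ma] := Sigma_nonempty Sa.
have h0 : 0 \in (0 :: [seq m%:Z | m <- a] : seq int) by exact: mem_head.
have hm : m%:Z \in (0 :: [seq m%:Z | m <- a] : seq int).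
  by rewrite inE map_f ?orbT.
pose u : K_vertex a := SeqSub h0; pose v : K_vertex a := SeqSub hm.
have uv : u != v.
  by rewrite -val_eqE /=; have := Sigma_gt0 Sa ma; lia.
have Kvu : K_graph v u by rewrite /K_graph /cayley /= subr0 mem_pm_nat.
have Kuv : K_graph u v by rewrite /K_graph /cayley /= sub0r pmN mem_pm_nat.
have cl : clique (@K_graph a) [set u; v]%SET.
  apply/forall_inP => x; rewrite !inE => xuv.
  apply/forall_inP => y; rewrite !inE => yuv.
  by case/orP: xuv yuv => /eqP-> /orP[]/eqP->; rewrite ?eqxx ?Kuv ?Kvu ?implybT.
rewrite /lambda /clique_number.
by apply: leq_trans (leq_bigmax_cond _ cl); rewrite cards2 uv.
Qed.

(* Deleting the apex 0, which is adjacent to every other vertex, leaves a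
   graph of chromatic number kappa a - 1: the colours of the other vertices
   are all colours but that of the apex. *)
Lemma color_apex (a : seq nat) (K : finType) (g : int -> K) :
  (#|K| <= kappa a)%N ->
  (forall u v, u - v \in pm a -> g u <> g v) ->
  forall (m : int) (j : K),
    (g m == j) = all (fun b => g (m + b%:Z) != j) a.
Proof.
move=> leK pg m j; apply/eqP/allP => [<- b ba|nj].
  apply/eqP; apply: pg; rewrite addrC addKr.
  exact: mem_pm_nat.
(* If [j] were missing at [m] as well, the translate of [K_graph a] to [m] would be properly colored
   by [K] without [j], that is with fewer than [kappa a] colors. *)
apply: contrapT => gmj.
pose K' : finType := {k : K | k != j}.
have cj (v : K_vertex a) : g (m + val v) != j.
  case: v => v /=; rewrite inE => /orP[/eqP->|/mapP[b ba ->]].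
    by rewrite addr0; apply/eqP.
  exact: nj.
pose c (v : K_vertex a) : K' := Sub (g (m + val v)) (cj v).
have pc : proper_coloring (@K_graph a) c.
  move=> u v /= uv /(congr1 val) /=; apply: pg.
  by rewrite opprD addrACA subrr add0r; exact: uv.
have := chromatic_number_le pc.
rewrite card_sig -/(kappa a) => h.
have := leq_trans leK h.
have := cardC1 j; rewrite /predC1 /= => ->.
have : (0 < #|K|)%N by apply/card_gt0P; exists j.
by case: #|K| => // n _; rewrite ltnn.
Qed.

(** Two of any [#|W| + 1] consecutive windows of length [L] agree, and their agreement propagates to
    the left. This gives a period [d <= #|W|] that depends on [g]; the factorial is a common
    multiple of all such periods. *)
Lemma determined_periodic (K : finType) (L : nat) :
  exists2 N, (0 < N)%N &
  forall g : int -> K,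
   (forall p q : int, (forall b, (1 <= b <= L)%N -> g (p + b%:Z) = g (q + b%:Z)) ->
      g p = g q) ->
   forall m : int, g (m + N%:Z) = g m.
Proof.
pose W := {ffun 'I_L -> K}; exists (#|W|)`!; first exact: fact_gt0.
move=> g det m.
pose w (p : int) : W := [ffun i : 'I_L => g (p + (i.+1)%:Z)].
have wE p q : w p = w q -> forall b, (1 <= b <= L)%N -> g (p + b%:Z) = g (q + b%:Z).
  move=> pq [//|b] /= bL.
  by have := congr1 (fun f : W => f (Ordinal bL)) pq; rewrite !ffunE.
have down p q : w p = w q -> forall t : nat, w (p - t%:Z) = w (q - t%:Z).
  move=> pq; elim=> [|t IH]; first by rewrite !subr0.
  have e r : r - t.+1%:Z = r - t%:Z - 1 by lia.
  rewrite !e; set p' := p - _ in IH *; set q' := q - _ in IH *.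
  apply/ffunP => i; rewrite !ffunE.
  have e' r : r - 1 + i.+1%:Z = r + i%:Z :> int by lia.
  rewrite !e' {e'}; case: i => [[|i]] iL /=; last by apply: wE => //; apply: ltnW.
  by rewrite !addr0; apply: det; exact: wE.
(* The windows compared start far enough to the right of [m] that every step of length [d] from [m]
   up to [M] is covered by [per]. *)
set M := m + (#|W|)`!%:Z.
pose h (i : 'I_(#|W|).+1) := w (M + i%:Z).
have [i [j [ij hij]]] : exists i j : 'I_(#|W|).+1, (i < j)%N /\ h i = h j.
  have /injectivePn[i [j ij hij]] : ~~ injectiveb h.
    apply/negP => /injectiveP/leq_card; rewrite card_ord.
    by rewrite ltnn.
  by case: (ltngtP i j) => [lt|gt|/val_inj e]; [exists i, j|exists j, i|rewrite e eqxx in ij].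
have /dvdnP[q Nq] : (j - i %| (#|W|)`!)%N.
  by apply: dvdn_fact; rewrite subn_gt0 ij /= (leq_trans (leq_subr _ _)) // -ltnS.
set d := (j - i)%N in Nq.
have per (r : int) : r <= M -> g (r + d%:Z) = g r.
  move=> rM; have [t rE] : exists t : nat, r = M + i%:Z - t%:Z.
    by exists (absz (M + i%:Z - r)%R); lia.
  have /wE eqw := down _ _ hij t.
  by rewrite rE (det _ _ eqw); congr g; lia.
suff H k : (k <= q)%N -> g (m + (k * d)%N%:Z) = g m by rewrite /M Nq H.
elim: k => [|k IH] kq; first by rewrite mul0n addr0.
rewrite -IH; last exact: ltnW.
rewrite mulSn PoszD (addrC d%:Z) addrA per //.
have : (k * d <= (#|W|)`!)%N by rewrite Nq leq_mul2r (ltnW kq) orbT.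
by rewrite -lez_nat -(lerD2l m).
Qed.
(** * Baire category on the space of bi-infinite binary sequences *)

Definition cyl (F : seq int) (y : twoZ) : set twoZ :=
  [set z | forall i, i \in F -> z i = y i].

Lemma cyl_refl F y : cyl F y y.
Proof. by []. Qed.

Lemma cyl_catl F G y : cyl (F ++ G) y `<=` cyl F y.
Proof. by move=> z h i iF; apply: h; rewrite mem_cat iF. Qed.

Lemma cyl_catr F G y : cyl (F ++ G) y `<=` cyl G y.
Proof. by move=> z h i iF; apply: h; rewrite mem_cat iF orbT. Qed.

Lemma cyl_center F y z : cyl F y z -> cyl F z = cyl F y.
Proof.
move=> h; apply/seteqP; split=> w hw i iF.
  by rewrite hw ?h.
by rewrite hw ?h.
Qed.

(* Up to the coordinates outside F every point is the indicator function of a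
   finite set, so there are only countably many cylinders. *)
Lemma cyl_finite F y : cyl F (fun i => i \in [seq j <- F | y j]) = cyl F y.
Proof. by apply: cyl_center => i iF; rewrite mem_filter iF andbT. Qed.

(** The sets containing a cylinder around [x] form a filter that converges to [x] in each
    coordinate, hence in the product topology. *)
Lemma nbhs_cyl (V : set twoZ) x : nbhs x V -> exists F, cyl F x `<=` V.
Proof.
pose FF : set_system twoZ := [set V | exists F, cyl F x `<=` V].
have FFfil : Filter FF.
  split=> [|P Q [F FP] [G GQ]|P Q PQ [F FP]]; first by exists [::].
    exists (F ++ G) => z zFG; split.
      exact: FP (cyl_catl zFG).
    exact: GQ (cyl_catr zFG).
  by exists F => z /FP /PQ.
suff : FF --> x by apply.
apply/cvg_sup => i A /= [B [[W oW <-] Wx BA]].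
exists [:: i] => z zi; apply: BA => /=.
by rewrite zi ?mem_head.
Qed.

Lemma cyl_nbhs F x : nbhs x (cyl F x).
Proof.
elim: F => [|i F IH]; first by apply: filterS filterT => z _ i.
have nx : nbhs (x : twoZ) [set z : twoZ | z i = x i].
  apply: (@proj_continuous int (fun=> bool) i x [set x i]).
  exact: discrete_set1.
apply: filterS2 IH nx => z zF zi j; rewrite inE => /orP[/eqP->|/zF] //.
Qed.

(* Sets with dense interior: comeager sets are those containing a countable
   intersection of thick sets. *)
Definition thick (D : set twoZ) :=
  forall F y, exists F' y', cyl F' y' `<=` cyl F y `&` D.

Lemma baire (I : countType) (D : I -> set twoZ) :
  (forall i, thick (D i)) -> forall F y, exists x, cyl F y x /\ forall i, D i x.
Proof.
move=> tD F y.
have /choice[step stepP] : forall np : nat * (seq int * twoZ), exists q : seq int * twoZ,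
    cyl q.1 q.2 `<=` cyl np.2.1 np.2.2 /\
    (forall i : I, unpickle np.1 = Some i -> cyl q.1 q.2 `<=` D i).
  move=> [n [G z]] /=; case: (@unpickle I n) => [i|]; last first.
    by exists (G, z); split.
  have [G' [z' h]] := tD i G z.
  by exists (G', z'); split=> [w /h[]//|_ [<-] w /h[]].
(* Stage [k] enters the set with code [k] and also fixes the integer coordinate with code [k]. The
   centers therefore stabilize at every coordinate, and the limit is read off without
   compactness. *)
pose p := fix p n : seq int * twoZ := if n is k.+1 then
  let q := step (k, p k) in
  ((if unpickle k is Some j then [:: j] else [::]) ++ q.1, q.2) else (F, y).
pose C n := cyl (p n).1 (p n).2.
have CS n : C n.+1 `<=` C n by move=> z /cyl_catr /(stepP (n, p n)).1.
have Cle m n : (m <= n)%N -> C n `<=` C m.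
  elim: n => [|n IH]; first by rewrite leqn0 => /eqP->.
  by rewrite leq_eqVlt => /orP[/eqP->//|/IH h z /CS /h].
pose x : twoZ := fun i => (p (pickle i).+1).2 i.
have Cx n : C n x.
  move=> i iF; rewrite /x; set k := (pickle i).+1.
  have [nk|/ltnW kn] := leqP n k.
    exact: (Cle n k nk _ (@cyl_refl _ _) i iF).
  apply/esym/(Cle k n kn _ (@cyl_refl _ _)).
  by rewrite /k /= pickleK mem_head.
exists x; split=> [|i]; first exact: Cx 0%N.
have /cyl_catr := Cx (pickle i).+1.
by apply: (stepP (pickle i, _)).2; rewrite pickleK.
Qed.

(** * The shift action and the free part *)

Lemma zshiftD s t x : zshift s (zshift t x) = zshift (s + t) x.
Proof. by apply/funext => m; rewrite /zshift addrA. Qed.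

Lemma zshift0 x : zshift 0 x = x.
Proof. by apply/funext => m; rewrite /zshift addr0. Qed.

Lemma zshift_cyl t F y z :
  cyl F (zshift t y) (zshift t z) <-> cyl [seq i + t | i <- F] y z.
Proof.
split=> [h _ /mapP[i iF ->]|h i iF]; first exact: h.
by apply: h; exact: map_f.
Qed.

Lemma zshift_inj s : injective (zshift s).
Proof.
by move=> x y /(congr1 (zshift (- s))); rewrite !zshiftD addNr !zshift0.
Qed.

Lemma zshift_free s x : free_part x -> free_part (zshift s x).
Proof.
move=> fx t t0; rewrite zshiftD addrC -zshiftD => /zshift_inj; exact: fx.
Qed.

Definition fshift (s : int) (x : free_part) : free_part :=
  SigSub (mem_set (@zshift_free s _ (set_valP x))).

Lemma fshiftE s x : set_val (fshift s x) = zshift s (set_val x).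
Proof. by []. Qed.

Lemma fshiftD s t x : fshift s (fshift t x) = fshift (s + t) x.
Proof. by apply: val_inj; exact: zshiftD. Qed.

Lemma fshift0 x : fshift 0 x = x.
Proof. by apply: val_inj; exact: zshift0. Qed.

Lemma thick_zshift t D : thick D -> thick (zshift t @^-1` D).
Proof.
move=> tD F y; have [G [z h]] := tD [seq i - t | i <- F] (zshift t y).
exists [seq i + t | i <- G], (zshift (- t) z) => w.
move=> /(zshift_cyl t G _ w).2; rewrite zshiftD subrr zshift0 => /h[hw Dw]; split=> // i iF.
by have := hw _ (map_f _ iF); rewrite /zshift subrK.
Qed.

Lemma seq_int_bounded (F : seq int) : exists M : nat, {in F, forall i, `|i| <= M%:Z}.
Proof.
elim: F => [|i F [M hM]]; first by exists 0%N.
exists (maxn M (absz i)) => j; rewrite inE => /orP[/eqP->|/hM]; lia.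
Qed.

(** A coordinate [i] outside [F] can be made to differ from coordinate [i + s]. Keeping [s != 0]
    inside the set lets the family range over the countable type [int]. *)
Lemma thick_free (s : int) : thick [set z | s != 0 -> zshift s z <> z].
Proof.
move=> F y; have [M hM] := seq_int_bounded F; pose i : int := M.+1%:Z.
have iF : i \notin F by apply/negP => /hM; rewrite /i; lia.
pose y' : twoZ := fun j => if j == i then ~~ y (i + s) else y j.
exists (i :: i + s :: F), y' => z hz; split.
  move=> j jF; rewrite hz ?inE ?jF ?orbT // /y'.
  by case: eqP => // ji; rewrite -ji jF in iF.
move=> s0 /(congr1 (fun f : twoZ => f i)); rewrite /zshift.
rewrite !hz ?inE ?eqxx ?orbT // /y' eqxx.
by rewrite -[X in _ == X]addr0 (inj_eq (addrI _)) (negbTE s0); case: (y _).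
Qed.

(** Freeness is itself a countable conjunction of thick conditions, which joins the given ones. *)
Lemma baire_free (I : countType) (D : I -> set twoZ) :
  (forall i, thick (D i)) ->
  forall F y, exists x : free_part, cyl F y (set_val x) /\ forall i, D i (set_val x).
Proof.
move=> tD F y.
pose E (u : I + int) := match u with
  inl i => D i | inr s => [set z | s != 0 -> zshift s z <> z] end.
have [|x [xF xE]] := @baire _ E _ F y.
  by case=> [i|s] /=; [exact: tD|exact: thick_free].
have fx : free_part x by move=> s; exact: (xE (inr s)).
by exists (SigSub (mem_set fx)); split=> // i; exact: (xE (inl i)).
Qed.

(** * Borel sets have the Baire property *)

(* B is comeager in the part of the cylinder that lies in free_part. *)
Definition forces F y (B : set free_part) := exists D : nat -> set twoZ,
  (forall n, thick (D n)) /\ forall x : free_part,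
    cyl F y (set_val x) -> (forall n, D n (set_val x)) -> B x.

Lemma thickT : thick setT.
Proof. by move=> F y; exists F, y => z. Qed.

Lemma forces_countable (I : countType) (D : I -> set twoZ) F y (B : set free_part) :
  (forall i, thick (D i)) ->
  (forall x : free_part, cyl F y (set_val x) -> (forall i, D i (set_val x)) -> B x) ->
  forces F y B.
Proof.
move=> tD h.
exists (fun n => if unpickle n is Some i then D i else setT); split=> [n|x xF xD].
  by case: unpickle => // ; exact: thickT.
by apply: h => // i; have := xD (pickle i); rewrite pickleK.
Qed.

Lemma forcesS F y F' y' (B B' : set free_part) :
  cyl F' y' `<=` cyl F y -> B `<=` B' -> forces F y B -> forces F' y' B'.
Proof. by move=> sF sB [D [tD h]]; exists D; split=> // x /sF /h hx /hx /sB. Qed.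

(* Plays the role of the Baire property. *)
Definition decided (B : set free_part) := forall F y, exists F' y',
  cyl F' y' `<=` cyl F y /\ (forces F' y' B \/ forces F' y' (~` B)).

Lemma decidedC B : decided B -> decided (~` B).
Proof.
move=> dB F y; have [F' [y' [sF h]]] := dB F y; exists F', y'; split=> //.
by rewrite setCK; case: h; [right|left].
Qed.

Lemma decided_open (U : set free_part) : open U -> decided U.
Proof.
move=> [V oV <-] F y.
have [[z [Fz Vz]]|no] := pselect (exists z, cyl F y z /\ V z).
  have [G sG] := nbhs_cyl (open_nbhs_nbhs (conj oV Vz)).
  exists (F ++ G), z; split.
    by rewrite -(cyl_center Fz); exact: cyl_catl.
  by left; exists (fun=> setT); split=> [_|x /cyl_catr/sG]//; exact: thickT.
exists F, y; split=> //; right; exists (fun=> setT); split=> [_|x xF _ Vx].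
  exact: thickT.
by apply: no; exists (set_val x).
Qed.

Lemma forces_bigcup (A : nat -> set free_part) : (forall n, decided (A n)) ->
  forall F y, (exists n F' y', cyl F' y' `<=` cyl F y /\ forces F' y' (A n)) \/
    forces F y (~` \bigcup_n A n).
Proof.
move=> dA F y; set P := (X in X \/ _).
have [|no] := pselect P; [by left|right].
pose code (c : seq int * seq int) := cyl c.1 (fun i => i \in c.2).
pose good n (c : seq int * seq int) := forces c.1 (fun i => i \in c.2) (~` A n).
have /choice[D DP] : forall nc : nat * (seq int * seq int), exists D : nat -> set twoZ,
    (forall k, thick (D k)) /\ (good nc.1 nc.2 -> forall x : free_part,
      code nc.2 (set_val x) -> (forall k, D k (set_val x)) -> ~ A nc.1 x).
  move=> [n c] /=; have [[D [tD h]]|] := pselect (good n c); first by exists D.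
  by exists (fun=> setT); split=> // _; exact: thickT.
pose E (u : (nat * (seq int * seq int)) * nat + nat) : set twoZ := match u with
  | inl (nc, k) => D nc k
  | inr n => [set z | cyl F y z -> exists2 c, good n c & code c z] end.
apply: (@forces_countable _ E) => [[[nc k]|n]|x xF xE [n _]] /=.
- exact: (DP nc).1.
- move=> G w; have [[z [Gz Fz]]|dis] := pselect (exists z, cyl G w z /\ cyl F y z).
    have [H [v [sH HA]]] := dA n (G ++ F) z.
    have sG : cyl H v `<=` cyl G w.
      by rewrite -(cyl_center Gz) => u /sH /cyl_catl.
    have sF : cyl H v `<=` cyl F y.
      by rewrite -(cyl_center Fz) => u /sH /cyl_catr.
    exists H, v => u Hu; split=> [|_]; first exact: sG.
    case: HA => [HA|HA]; first by case: no; exists n, H, v.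
    exists (H, [seq j <- H | v j]); last by rewrite /code cyl_finite.
    by apply: forcesS HA => //; rewrite cyl_finite.
  by exists G, w => z Gz; split=> // Fz; case: dis; exists z.
- have [c gc cx] := xE (inr n) xF.
  apply: (DP (n, c)).2 => // k; exact: xE (inl (n, c, k)).
Qed.

Lemma decided_bigcup (A : nat -> set free_part) :
  (forall n, decided (A n)) -> decided (\bigcup_n A n).
Proof.
move=> dA F y; have [[n [G [z [sG fA]]]]|] := forces_bigcup dA F y.
  by exists G, z; split=> //; left; apply: forcesS fA => // x Ax; exists n.
by exists F, y; split=> //; right.
Qed.

(** The decided sets form a sigma-algebra containing the open sets. *)
Lemma decided_borel (B : set free_part) : <<s (@open free_part) >> B -> decided B.
Proof.
apply: smallest_sub => [|U]; last exact: decided_open.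
split=> [|A dA|A dA]; last exact: decided_bigcup.
  by apply: decided_open; exact: open0.
by rewrite setTD; exact: decidedC.
Qed.

Lemma borel_recurrent_color (K : finType) (c : free_part -> K) (b : int) (N : nat) :
  (0 < N)%N -> borel_map c ->
  exists (x : free_part) (k : nat), c (fshift (b + (k * N)%N%:Z) x) = c x.
Proof.
move=> N0 bc.
(* Color classes are indexed by [nat] to fit [forces_bigcup]; those beyond [#|K|] are empty. *)
pose A n : set free_part := c @^-1` [set j | enum_rank j = n :> nat].
have dA n : decided (A n) by apply: decided_borel; exact: bc.
have [[n [F [y [_ [D [tD h]]]]]]|[D [tD h]]] := forces_bigcup dA [::] (fun=> false : bool);
    last first.
  have [x [_ xD]] := baire_free tD [::] (fun=> false).
  by case: (h x) => //; exists (enum_rank (c x)).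
have [M hM] := seq_int_bounded F.
(* With [F] inside [[-M, M]], a shift [t > 2 * M] makes [F] and [F + t] disjoint; [absz b]
   compensates for a negative [b]. *)
pose k := (absz b + 2 * M + 1)%N; pose t : int := b + (k * N)%N%:Z.
have tM : 2 * M%:Z < t.
  have : (k <= k * N)%N by rewrite leq_pmulr.
  by rewrite /t /k; lia.
pose E (u : nat + nat) := match u with
  inl m => D m | inr m => zshift t @^-1` D m end.
(* [y'] carries [y] on [F] and a translated copy of it on [F + t], so near [y'] both [x] and its
   shift by [t] lie in [cyl F y]. *)
pose y' : twoZ := fun i => if i \in F then y i else y (i - t).
have [|x [xF xE]] := @baire_free _ E _ (F ++ [seq i + t | i <- F]) y'.
  by case=> m /=; [exact: tD|exact: thick_zshift].
have cx : A n x.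
  apply: h => [i iF|m]; last exact: (xE (inl m)).
  by rewrite (cyl_catl xF) // /y' iF.
have ctx : A n (fshift t x).
  apply: h => [i iF|m]; last exact: (xE (inr m)).
  have iFt : i + t \in [seq j + t | j <- F] by apply: (map_f (fun j => j + t)).
  rewrite fshiftE /zshift (cyl_catr xF iFt) /y' addrK.
  by case: ifP => // /hM; have := hM _ iF; lia.
by exists x, k; apply/enum_rank_inj/val_inj; rewrite /= cx ctx.
Qed.

(** * Finite Borel colorings of the free part *)

Section Borel.
Variable X : topologicalType.
Local Notation borel := (<<s @open X >>).

Lemma borel_open (A : set X) : open A -> borel A.
Proof. exact: sub_sigma_algebra. Qed.

Lemma borel_setC (A : set X) : borel A -> borel (~` A).
Proof.
have [_ bC _] := smallest_sigma_algebra setT (@open X).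
by rewrite -setTD; exact: bC.
Qed.

Lemma borel_bigcup (A : nat -> set X) : (forall n, borel (A n)) -> borel (\bigcup_n A n).
Proof.
have [_ _ bU] := smallest_sigma_algebra setT (@open X).
exact: bU.
Qed.

Lemma borel_setU (A B : set X) : borel A -> borel B -> borel (A `|` B).
Proof.
move=> bA bB; rewrite -bigcup2E; apply: borel_bigcup => -[|[|n]] //=.
exact: borel_open open0.
Qed.

Lemma borel_setI (A B : set X) : borel A -> borel B -> borel (A `&` B).
Proof.
move=> bA bB; rewrite -[A]setCK -[B]setCK -setCU; apply: borel_setC.
by apply: borel_setU; exact: borel_setC.
Qed.

Lemma borel_preimage (f : X -> X) (A : set X) :
  (forall U : set X, open U -> open (f @^-1` U)) -> borel A -> borel (f @^-1` A).
Proof.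
move=> cf; move: A; apply: (@smallest_sub _ _ _ [set A | borel (f @^-1` A)]).
  split=> [|A bA|A bA] /=.
  - by rewrite preimage_set0; exact: borel_open open0.
  - by rewrite setTD preimage_setC; exact: borel_setC.
  - by rewrite preimage_bigcup; exact: borel_bigcup.
by move=> U /cf/borel_open.
Qed.

Lemma borel_map_cst (K : Type) (k : K) : borel_map (fun _ : X => k).
Proof.
move=> S; rewrite preimage_cst; case: ifP => _; apply: borel_open.
  exact: openT.
exact: open0.
Qed.

Lemma borel_map_if (K : Type) (A : set X) (f g : X -> K) :
  borel A -> borel_map f -> borel_map g ->
  borel_map (fun x => if `[< A x >] then f x else g x).
Proof.
move=> bA bf bg S.
rewrite (_ : _ @^-1` S = (A `&` f @^-1` S) `|` (~` A `&` g @^-1` S)).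
  by apply: borel_setU; apply: borel_setI => //; exact: borel_setC.
apply/seteqP; split=> x /=; case: asboolP => Ax.
- by left.
- by right.
- by case=> -[].
- by case=> -[].
Qed.

Lemma borel_map_pair (K L : finType) (f : X -> K) (g : X -> L) :
  borel_map f -> borel_map g -> borel_map (fun x => (f x, g x)).
Proof.
move=> bf bg S.
(* The preimage is sliced by the value of [f], indexed by its code so that [borel_bigcup]
   applies. *)
rewrite (_ : _ @^-1` S = \bigcup_n (f @^-1` [set k | pickle k = n] `&`
    g @^-1` [set l | exists2 k, pickle k = n & S (k, l)])).
  by apply: borel_bigcup => n; apply: borel_setI.
apply/seteqP; split=> [x Sx|x [n _ [/= <- [k /(pcan_inj pickleK) ->]]]] //=.
by exists (pickle (f x)) => //; split=> //; exists (f x).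
Qed.

(* Scan the independent sets B 0, B 1, ... and keep every point whose
   neighbours have not been kept before: the union of the stages is a maximal
   independent set of the graph joining x and T x.  Its complement splits into
   components with at most two points. *)
Lemma borel_3coloring (T T' : X -> X) (B : nat -> set X) :
  cancel T T' -> cancel T' T ->
  (forall U : set X, open U -> open (T @^-1` U)) ->
  (forall U : set X, open U -> open (T' @^-1` U)) ->
  (forall n, borel (B n)) -> (forall x, exists n, B n x) ->
  (forall n x, B n x -> ~ B n (T x)) ->
  exists c : X -> 'I_3, borel_map c /\ forall x, c x <> c (T x).
Proof.
move=> TK T'K cT cT' bB covB indB.
pose A := fix A n : set X := if n is k.+1 then
  A k `|` (B k `&` ~` (T @^-1` A k) `&` ~` (T' @^-1` A k)) else set0.
have bA n : borel (A n).
  elim: n => [|n IH] /=; first exact: borel_open open0.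
  apply: borel_setU => //; do 2?[apply: borel_setI => //];
    by apply: borel_setC; exact: borel_preimage.
pose M := \bigcup_n A n.
have bM : borel M by exact: borel_bigcup.
have Ale m n : (m <= n)%N -> A m `<=` A n.
  elim: n => [|n IH]; first by rewrite leqn0 => /eqP->.
  by rewrite leq_eqVlt => /orP[/eqP->//|/IH h z /h]; left.
have Aind n x : A n x -> ~ A n (T x).
  elim: n x => [//|n IH] x /= [Ax|[[Bx nTx] nT'x]] [ATx|[[BTx nTTx] nT'Tx]].
  - exact: IH Ax ATx.
  - by apply: nT'Tx; rewrite /= TK.
  - exact: nTx.
  - exact: indB Bx BTx.
have Mind x : M x -> ~ M (T x).
  move=> [m _ Amx] [n _ AnTx]; apply: (Aind (maxn m n) x).
    by apply: Ale Amx; exact: leq_maxl.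
  by apply: Ale AnTx; exact: leq_maxr.
have Mmax x : ~ M x -> ~ M (T x) -> M (T' x).
  move=> nM nMT; apply: contrapT => nMT'; have [n Bx] := covB x.
  by apply: nM; exists n.+1 => //; right; split; first split=> //;
    move=> h; [apply: nMT|apply: nMT']; exists n.
(* If [x] and [T x] both had color 2, then [T x] and both its neighbors would lie outside [M],
   against maximality. If [x] has color 1, then [T x] has color 0. *)
exists (fun x => if `[< M x >] then 0 else
  if `[< (T @^-1` M) x >] then 1 else 2%:R); split.
  apply: borel_map_if => //; first exact: borel_map_cst.
  apply: borel_map_if; last exact: borel_map_cst.
    exact: borel_preimage.
  exact: borel_map_cst.
move=> x; case: asboolP => Mx.
  by rewrite asboolF; [case: asboolP => _ /(congr1 val)|exact: Mind].
case: asboolP => /= MTx; first by move/(congr1 val).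
case: asboolP => [_ /(congr1 val)//|/= nTTx _].
by have := Mmax _ MTx nTTx; rewrite TK.
Qed.

End Borel.

(** * Borel colorings for the shifts *)

Lemma open_cylP (V : set twoZ) :
  open V <-> forall x, V x -> exists F, cyl F x `<=` V.
Proof.
split=> [oV x Vx|h]; first by apply: nbhs_cyl; exact: open_nbhs_nbhs.
by rewrite openE => x /h[F sF]; exact: filterS sF (cyl_nbhs F x).
Qed.

Lemma open_preimage_fshift s (U : set free_part) : open U -> open (fshift s @^-1` U).
Proof.
move=> [V oV <-]; exists (zshift s @^-1` V) => //.
apply/open_cylP => x Vx; have [F sF] := (open_cylP V).1 oV _ Vx.
by exists [seq i + s | i <- F] => z /(zshift_cyl s F x z).2/sF.
Qed.

(** A free point differs from its shift at some coordinate [i]. Fixing [i] and the value [e] there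
    gives an open set that cannot contain both a point and its shift, since the shift has value
    [~~ e] at [i]. *)
Lemma fshift_3coloring (s : int) : s != 0 ->
  exists c : free_part -> 'I_3, borel_map c /\ forall x, c x <> c (fshift s x).
Proof.
move=> s0.
pose B n : set free_part := set_val @^-1` [set z : twoZ |
  exists i e, [/\ pickle (i, e) = n, z i = e & z (i + s) = ~~ e]].
apply: (@borel_3coloring _ _ (fshift (- s)) B).
- by move=> x; rewrite fshiftD addNr fshift0.
- by move=> x; rewrite fshiftD subrr fshift0.
- exact: open_preimage_fshift.
- exact: open_preimage_fshift.
- move=> n; apply: borel_open; eexists; last by reflexivity.
  apply/open_cylP => z [i [e [ine zi zis]]]; exists [:: i; i + s] => w hw.
  by exists i, e; rewrite !hw ?inE ?eqxx ?orbT.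
- move=> x; have /existsNP[i xi] : ~ forall i, zshift s (set_val x) i = set_val x i.
    by move=> /funext; exact: (set_valP x).
  exists (pickle (i, set_val x i)), i, (set_val x i); split=> //.
  by move: xi; rewrite /zshift; case: (set_val x _); case: (set_val x i).
- move=> n x [i [e [<- xi xis]]] [j [f [/(pcan_inj pickleK)[-> ->] ]]].
  by rewrite fshiftE /zshift xis => h _; case: (e) h.
Qed.

(** The product of the 3-colorings for the single shifts is proper for all of them at once. *)
Lemma fshifts_finite_coloring (S : seq int) : (forall s, s \in S -> s != 0) ->
  exists (K : finType) (c : free_part -> K), borel_map c /\
    forall s x, s \in S -> c x <> c (fshift s x).
Proof.
elim: S => [_|s S IH nz].
  by exists unit, (fun=> tt); split=> //; exact: borel_map_cst.
have [|K [c [bc pc]]] := IH.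
  by move=> t tS; apply: nz; rewrite inE tS orbT.
have [d [bd pd]] := fshift_3coloring (nz s (mem_head _ _)).
exists (K * 'I_3)%type, (fun x => (c x, d x)); split.
  exact: borel_map_pair.
move=> t x; rewrite inE => /orP[/eqP->|tS] [cE dE]; first exact: pd dE.
exact: pc tS cE.
Qed.

(** * The strict inequality between [kappa] and [chi] *)

Lemma chi_attained (a : seq nat) : Sigma a ->
  exists (K : finType) (c : free_part -> K),
    [/\ #|K| = chi a, borel_map c & proper_coloring (@schreier (pm a)) c].
Proof.
move=> Sa; have [|K [c [bc pc]]] := @fshifts_finite_coloring (pm a).
  by move=> s; exact: pm_neq0.
(* A finite Borel coloring exists, so [chi a] is a true minimum and not the default 0 of [least]. *)
have P0 : [set k | exists (K : finType) (c : free_part -> K), [/\ #|K| = k,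
    borel_map c & proper_coloring (@schreier (pm a)) c]] #|K|.
  exists K, c; split=> // x y [s sS xy].
  by rewrite (_ : y = fshift s x); [exact: pc|exact/val_inj/esym].
exact: (leastP P0).1.
Qed.

Lemma kappa_lt_chi (a : seq nat) : Sigma a -> (kappa a < chi a)%N.
Proof.
move=> Sa; have [K [c [<- bc pc]]] := chi_attained Sa.
rewrite ltnNge; apply/negP => leK.
have [L aL] : exists L, forall b, b \in a -> (1 <= b <= L)%N.
  exists (\max_(b <- a) b)%N => b ba; rewrite (Sigma_gt0 Sa ba).
  exact: leq_bigmax_seq.
have [N N0 perN] := determined_periodic K L.
have cN x (k : nat) (s : int) : c (fshift (s + (k * N)%N%:Z) x) = c (fshift s x).
  elim: k s => [|k IH] s; first by rewrite mul0n addr0.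
  rewrite mulSn PoszD addrA IH.
  pose g m := c (fshift m x); apply: (perN g) => p q eqg.
  have pg u v : u - v \in pm a -> g u <> g v.
    move=> uv; apply/nesym/pc; exists (u - v) => //.
    by rewrite !fshiftE zshiftD subrK.
  (* By [color_apex] a color is recognized from the colors at distances [b \in a] to its right, so
     equal windows force equal colors. *)
  have apex := color_apex leK pg.
  apply/esym/eqP; rewrite apex; apply/allP => b ba.
  rewrite -(eqg b (aL b ba)).
  by have := apex p (g p); rewrite eqxx => /esym/allP/(_ b ba).
have [b ba] := Sigma_nonempty Sa.
have [x [k]] := borel_recurrent_color b%:Z N0 bc.
(* Periodicity removes [k * N], leaving equal colors at [x] and its neighbor [fshift b x]. *)
rewrite cN => /esym; apply: pc.
by exists b%:Z; rewrite ?mem_pm_nat.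
Qed.

End LowerBound.

Theorem theorem5p4 (a : seq nat) (ha : Sigma a) :
  [/\ chi a >= kappa a + 1,
      kappa a + 1 >= lambda a + 1
    & lambda a + 1 >= 3].
Proof.
split; first by rewrite addn1 kappa_lt_chi.
  by rewrite leq_add2r clique_number_le_chromatic //; exact: K_graph_irr.
by rewrite addn1 ltnS lambda_ge2.
Qed.
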